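(* Let $\mathcal{P}$ be a PTRS and let $\mathfrak{T}$ be a $\to_{\mathcal{P}}$-RST with $\operatorname{h}(\mathfrak{T})>0$ whose root is labeled with the term $t$. If $\sum_{v\text{ leaf of }\mathfrak{T}} p_v\cdot \operatorname{maxOO}(t,t_v) > 1$, then $\mathcal{P}$ is not AST. If $\sum_{v\text{ leaf of }\mathfrak{T}} p_v\cdot \operatorname{maxOO}(t,t_v) \ge 1$, then $\mathcal{P}$ is not PAST.
   Context: Terms over a finite signature $\Sigma$ and variables $\mathcal{V}$; substitutions have finite domain and extend homomorphically. $\operatorname{Pos}(s)$ is the set of positions of $s$ ($\varepsilon$ the root), $s|_\pi$ the subterm at $\pi$, $s[r]_\pi$ replacement; $\operatorname{Pos}_\Sigma(t)$ is the set of positions of $t$ carrying a function symbol. Positions $\pi_1,\pi_2$ are orthogonal if neither is a prefix of the other. A PTRS is a finite set of rules $\ell\to\{p_1:r_1,\dots,p_k:r_k\}$ ($\ell\notin\mathcal{V}$, $p_j>0$ summing to $1$, variables of each $r_j$ occur in $\ell$), inducing $s\to_{\mathcal{P}}\{p_1:s[r_1\sigma]_\pi,\dots,p_k:s[r_k\sigma]_\pi\}$ whenever $s|_\pi=\ell\sigma$. A $\to_{\mathcal{P}}$-RST is a (possibly infinite) tree whose nodes $v$ are labeled $(p_v:t_v)$ with $p_v\in(0,1]$, terms $t_v$, root probability $1$, and each non-leaf node $v$ with children $w_1,\dots,w_k$ satisfying $t_v\to_{\mathcal{P}}\{\tfrac{p_{w_1}}{p_v}:t_{w_1},\dots,\tfrac{p_{w_k}}{p_v}:t_{w_k}\}$;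 leaves need not be normal forms. $\operatorname{h}(\mathfrak{T})$ is the supremum of node depths. For a $\to_{\mathcal{P}}$-RST $\mathfrak{T}$: $|\mathfrak{T}|=\sum_{v\text{ leaf}}p_v$; $\operatorname{edl}(\mathfrak{T})=\infty$ if $|\mathfrak{T}|<1$, else $\sum_{v\text{ leaf}}\operatorname{d}(v)p_v$ with $\operatorname{d}$ the depth. $\mathcal{P}$ is AST if $|\mathfrak{T}|=1$ for all $\to_{\mathcal{P}}$-RSTs, and PAST if $\operatorname{edl}(\mathfrak{T})<\infty$ for all of them. $t$ occurs in $s$ at position $\pi$ if $s|_\pi=t\sigma$ for some substitution $\sigma$. Positions $\pi_1,\pi_2$ are overlapping w.r.t. $t$ if there is $\tau\in\operatorname{Pos}_\Sigma(t)$ with $\pi_1=\pi_2.\tau$ or $\pi_2=\pi_1.\tau$. $\operatorname{NO}(t,s)$ is the set of all sets $S\subseteq\operatorname{Pos}(s)$ such that $t$ occurs in $s$ at every $\pi\in S$ and any two distinct positions of $S$ are non-overlapping w.r.t. $t$. $\operatorname{maxOO}(t,s)=\max\{|S| \mid S\in\operatorname{NO}(t,s),\ \text{any two distinct positions of } S \text{ are orthogonal}\}$. *)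

(* Defs.v *)
From HB Require Import structures.
From mathcomp Require Import all_boot all_order all_algebra finmap.
From mathcomp Require Import all_classical all_reals all_analysis.

Set Implicit Arguments.
Unset Strict Implicit.
Unset Printing Implicit Defensive.

Import Order.TTheory GRing.Theory Num.Theory.

Local Open Scope classical_set_scope.
Local Open Scope ring_scope.

Section Terms.
Variables (Sigma : finType) (ar : Sigma -> nat) (V : Type).

Inductive term : Type :=
| Var of V
| App (f : Sigma) of {ffun 'I_(ar f) -> term}.

(** Classical: [V] need not have decidable equality. *)
HB.instance Definition _ := gen_eqMixin term.
HB.instance Definition _ := gen_choiceMixin term.

Definition is_var (t : term) : bool := if t is Var _ then true else false.

Fixpoint vars (t : term) : set V :=
  match t with
  | Var x => [set x]
  | App f ts => [set x | exists i : 'I_(ar f), vars (ts i) x]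
  end.

Definition finite_dom (sigma : V -> term) : Prop :=
  finite_set [set x | sigma x <> Var x].

Fixpoint subst (sigma : V -> term) (t : term) : term :=
  match t with
  | Var x => sigma x
  | App f ts => App [ffun i => subst sigma (ts i)]
  end.

(** A position is a sequence of argument indices, counted from 0. *)
Fixpoint Pos (s : term) : {fset seq nat} :=
  match s with
  | Var _ => [fset [::]]%fset
  | App f ts =>
      ([::] |` \big[fsetU/fset0]_(i : 'I_(ar f))
                 [fset ((i : nat) :: pi) | pi in Pos (ts i)])%fset
  end.

(** [None] when [pi] is not a position of [s]. *)
Fixpoint subterm_at (s : term) (pi : seq nat) : option term :=
  match pi, s with
  | [::], _ => Some s
  | _ :: _, Var _ => None
  | i :: pi', App f ts =>
      if insub i is Some j then subterm_at (ts j) pi' else None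
  end.

(** [s] with the subterm at [pi] replaced by [r]; only meaningful for
    [pi \in Pos s]. *)
Fixpoint replace_at (s : term) (pi : seq nat) (r : term) : term :=
  match pi, s with
  | [::], _ => r
  | _ :: _, Var _ => s
  | i :: pi', App f ts =>
      App [ffun j : 'I_(ar f) =>
             if (j : nat) == i then replace_at (ts j) pi' r else ts j]
  end.

Definition PosSigma (t : term) : {fset seq nat} :=
  [fset pi in Pos t | if subterm_at t pi is Some u then ~~ is_var u else false]%fset.

Definition orthogonal (pi1 pi2 : seq nat) : bool :=
  ~~ prefix pi1 pi2 && ~~ prefix pi2 pi1.

Definition occurs_at (t s : term) (pi : seq nat) : Prop :=
  exists2 sigma, finite_dom sigma & subterm_at s pi = Some (subst sigma t).

Definition overlapping (t : term) (pi1 pi2 : seq nat) : Prop :=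
  exists2 tau, tau \in PosSigma t & pi1 = pi2 ++ tau \/ pi2 = pi1 ++ tau.

Definition NO (t s : term) : set {fset seq nat} :=
  [set S | [/\ (S `<=` Pos s)%fset,
               {in S, forall pi, occurs_at t s pi} &
               {in S &, forall pi1 pi2, pi1 != pi2 -> ~ overlapping t pi1 pi2}]].

Definition maxOO (t s : term) : nat :=
  \max_(S <- fpowerset (Pos s) |
        `[< NO t s S /\
            {in S &, forall pi1 pi2, pi1 != pi2 -> orthogonal pi1 pi2} >])
     #|` S|%fset.

End Terms.

Section PTRS.
Variables (R : realType) (Sigma : finType) (ar : Sigma -> nat) (V : Type).
Local Notation term := (term ar V).

(** A finite multi-distribution is a sequence, considered up to permutation. *)
Record rule := Rule { lhs : term ; rhs : seq (R * term) }.

Definition wf_rule (r : rule) : Prop :=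
  [/\ ~~ is_var (lhs r),
      {in rhs r, forall pr, 0 < pr.1},
      \sum_(pr <- rhs r) pr.1 = 1 &
      {in rhs r, forall pr, vars pr.2 `<=` vars (lhs r)}].

Record ptrs := PTRS {
  rules : set rule ;
  ptrs_finite : finite_set rules ;
  ptrs_wf : forall r, rules r -> wf_rule r
}.

Definition pstep (P : ptrs) (s : term) (mu : seq (R * term)) : Prop :=
  exists (r : rule) (pi : seq nat) (sigma : V -> term),
    [/\ rules P r, finite_dom sigma,
        subterm_at s pi = Some (subst sigma (lhs r)) &
        perm_eq mu [seq (pr.1, replace_at s pi (subst sigma pr.2)) | pr <- rhs r]].

(** The nodes of a tree are addressed by the sequences of child indices leading
    to them from the root [[::]], so that the depth of a node is its [size];
    [prob] and [lab] are irrelevant outside [node]. *)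
Record rst (P : ptrs) := RST {
  node : set (seq nat) ;
  prob : seq nat -> R ;
  lab : seq nat -> term ;
  node_root : node [::] ;
  node_parent : forall v j, node (rcons v j) -> node v ;
  prob_root : prob [::] = 1 ;
  prob_range : forall v, node v -> 0 < prob v <= 1 ;
  node_step : forall v, node v -> (exists j, node (rcons v j)) ->
    exists2 k, (forall j, node (rcons v j) <-> (j < k)%N) &
      pstep P (lab v)
        [seq (prob (rcons v j) / prob v, lab (rcons v j)) | j <- iota 0 k]
}.

Section Trees.
Variables (P : ptrs) (T : rst P).

Definition leaf : set (seq nat) :=
  [set v | node T v /\ forall j, ~ node T (rcons v j)].

Definition height : \bar R := ereal_sup [set (size v)%:R%:E | v in node T].

Definition mass : \bar R := (\esum_(v in leaf) (prob T v)%:E)%E.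

Definition edl : \bar R :=
  if (mass < 1)%E then +oo%E
  else (\esum_(v in leaf) ((size v)%:R * prob T v)%:E)%E.

End Trees.

Definition AST (P : ptrs) : Prop := forall T : rst P, mass T = 1%E.

Definition PAST (P : ptrs) : Prop := forall T : rst P, (edl T < +oo)%E.

End PTRS.

(* Main.v *)
(** Instances of [t] at orthogonal positions can be rewritten independently, so
    running [T] at one of them replaces it by [maxOO t (lab T v)] new ones with
    probability [prob T v]. Iterating this on a stack of pending orthogonal
    copies unfolds to a single tree, in which the number of copies performs the
    depth-first exploration of a Galton-Watson process with mean offspring the
    sum of the statement. If the mean exceeds 1, then [q ^ copies] is a
    supermartingale for some [q < 1], which bounds the mass of the leaves by
    [q]. If the mean is at least 1, the expected number [E] of steps satisfies
    [1 + E <= E], so that it is infinite. *)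

Require Import Defs.
From mathcomp Require Import all_boot all_order all_algebra finmap.
From mathcomp Require Import all_classical all_reals all_analysis.
From mathcomp Require Import lra zify.

Set Implicit Arguments.
Unset Strict Implicit.
Unset Printing Implicit Defensive.

Import Order.TTheory GRing.Theory Num.Theory.

Local Open Scope classical_set_scope.
Local Open Scope ring_scope.

(* The algebra library has another [orthogonal], on forms. *)
Local Notation orthogonal := Defs.orthogonal.

(** * Positions, substitutions and orthogonal occurrences *)

Section Terms.
Variables (Sigma : finType) (ar : Sigma -> nat) (V : Type).
Local Notation term := (term ar V).
Implicit Types (s t u r : term) (sigma tau : V -> term) (p q : seq nat).

(** The arguments sit inside a finite function, so the induction hypothesis about them is stated
    pointwise. *)
Lemma term_nested_ind (Q : term -> Prop) :
  (forall x, Q (Var ar x)) ->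
  (forall f (ts : {ffun 'I_(ar f) -> term}), (forall i, Q (ts i)) ->
     Q (App ts)) ->
  forall s, Q s.
Proof.
move=> Qv Qa; fix IH 1 => -[x|f ts]; first exact: Qv.
by apply: Qa => i; apply: IH.
Qed.

Lemma subst_comp sigma tau s :
  subst sigma (subst tau s) = subst (subst sigma \o tau) s.
Proof.
elim/term_nested_ind: s => [//|f ts IH] /=.
by congr App; apply/ffunP => i; rewrite !ffunE IH.
Qed.

Lemma finite_dom_comp sigma tau :
  finite_dom sigma -> finite_dom tau -> finite_dom (subst sigma \o tau).
Proof.
move=> fs ft; apply: (@sub_finite_set _ _
  ([set x | sigma x <> Var ar x] `|` [set x | tau x <> Var ar x])); last first.
  by rewrite finite_setU.
move=> x /= nx; case: (pselect (tau x = Var ar x)) => [e|]; last by right.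
by left; move: nx; rewrite e.
Qed.

Lemma subterm_at_nil s : subterm_at s [::] = Some s.
Proof. by case: s. Qed.

Lemma replace_at_nil s r : replace_at s [::] r = r.
Proof. by case: s. Qed.

Lemma subterm_at_cat s p q :
  subterm_at s (p ++ q) = obind (fun u => subterm_at u q) (subterm_at s p).
Proof.
elim: p s => [s|i p IH [x|f ts]] //=; first by rewrite subterm_at_nil.
by case: insub => [j|].
Qed.

Lemma subterm_at_subst sigma s p u :
  subterm_at s p = Some u -> subterm_at (subst sigma s) p = Some (subst sigma u).
Proof.
elim: p s => [s|i p IH [x|f ts]] //=; first by rewrite !subterm_at_nil => -[->].
by case: insub => [j|//]; rewrite ffunE; apply: IH.
Qed.

Lemma replace_at_cat s p q u r :
  subterm_at s p = Some u ->
  replace_at s (p ++ q) r = replace_at s p (replace_at u q r).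
Proof.
elim: p s => [s|i p IH [x|f ts]] //=.
  by rewrite subterm_at_nil !replace_at_nil => -[->].
case: insubP => [j _ ji|//] sj.
congr App; apply/ffunP => i'; rewrite !ffunE; case: eqP => // ei.
by apply: IH; rewrite (_ : i' = j) //; apply: val_inj; rewrite /= ji ei.
Qed.

Lemma replace_at_subst sigma s p u r :
  subterm_at s p = Some u ->
  replace_at (subst sigma s) p (subst sigma r) = subst sigma (replace_at s p r).
Proof.
elim: p s => [s|i p IH [x|f ts]] //=; first by rewrite !replace_at_nil.
case: insubP => [j _ ji|//] sj.
congr App; apply/ffunP => i'; rewrite !ffunE; case: eqP => // ei.
by apply: IH; rewrite (_ : i' = j) //; apply: val_inj; rewrite /= ji ei.
Qed.

Lemma subterm_at_replace s p u r :
  subterm_at s p = Some u -> subterm_at (replace_at s p r) p = Some r.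
Proof.
elim: p s => [s|i p IH [x|f ts]] //=.
  by rewrite replace_at_nil !subterm_at_nil.
by case: insubP => [j _ ji|//] sj; rewrite ffunE ji eqxx; apply: IH.
Qed.

Lemma subterm_at_replace_orthogonal s p q r :
  orthogonal p q -> subterm_at (replace_at s p r) q = subterm_at s q.
Proof.
rewrite /Defs.orthogonal.
elim: p s q => [s q|i p IH]; first by rewrite prefix0s.
case=> [x|f ts] [|j q] //=.
move=> o.
case: insubP => [k _ kj|//]; rewrite ffunE kj; case: eqP => // e.
by apply: IH; move: o; rewrite e eqxx.
Qed.

Lemma occurs_at_subterm s p u q t :
  occurs_at u s p -> occurs_at t u q -> occurs_at t s (p ++ q).
Proof.
move=> [sigma fs es] [tau ft eu]; exists (subst sigma \o tau).
  exact: finite_dom_comp.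
by rewrite subterm_at_cat es /= (subterm_at_subst _ eu) subst_comp.
Qed.

Lemma occurs_at_replace s p u sigma t :
  finite_dom sigma -> subterm_at s p = Some u ->
  occurs_at t (replace_at s p (subst sigma t)) p.
Proof. by move=> fs es; exists sigma => //; exact: subterm_at_replace es. Qed.

Lemma occurs_at_replace_orthogonal s p q r t :
  orthogonal p q -> occurs_at t s q -> occurs_at t (replace_at s p r) q.
Proof.
by move=> o [tau ft e]; exists tau; rewrite // subterm_at_replace_orthogonal.
Qed.

Lemma orthogonal_cat2l p q q' :
  orthogonal (p ++ q) (p ++ q') = orthogonal q q'.
Proof. by rewrite /Defs.orthogonal; elim: p => //= i p IH; rewrite eqxx. Qed.

Lemma orthogonal_cat_left p q p' : orthogonal p q -> orthogonal (p ++ p') q.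
Proof.
rewrite /Defs.orthogonal.
elim: p q => [//|i p IH] [|j q]; rewrite ?andbF //= eq_sym.
by case: (j == i) => //= /IH.
Qed.

(** A list instead of a set, since [state] keeps the pending positions as a stack. The value 0 of an
    empty maximum is witnessed by the empty list. *)
Lemma maxOO_witness t s : exists L : seq (seq nat),
  [/\ size L = maxOO t s, {in L, forall p, occurs_at t s p} &
      pairwise orthogonal L].
Proof.
rewrite /maxOO.
elim/big_ind: _ => [|m n [L [<- ? ?]] [L' [<- ? ?]]|S /asboolP[[_ occ _] ort]].
- by exists [::].
- by case: (leqP (size L) (size L')) => _; [exists L'|exists L].
- exists (enum_fset S); split => //.
  have sub p : p \in enum_fset S -> p \in S by [].
  elim: (enum_fset S) (fset_uniq S) sub => //= p L IH /andP[pL uL] sub.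
  rewrite IH // ?andbT; last by move=> q qL; apply: sub; rewrite inE qL orbT.
  apply/allP => q qL; apply: ort; last by apply: contraNneq pL => ->.
    by apply: sub; rewrite inE eqxx.
  by apply: sub; rewrite inE qL orbT.
Qed.

End Terms.

(** * Rewrite steps as distributions, and their closure under instances in a context *)

Section Pstep.
Variables (R : realType) (Sigma : finType) (ar : Sigma -> nat) (V : Type).
Variable P : ptrs R ar V.
Local Notation term := (term ar V).

Lemma pstep_distr (s : term) mu : pstep P s mu ->
  {in mu, forall pr, 0 < pr.1} /\ \sum_(pr <- mu) pr.1 = 1.
Proof.
case=> r [pi [sigma [Pr _ _ mur]]]; have [_ pos sum1 _] := ptrs_wf Pr.
split=> [pr|]; last by rewrite (perm_big _ mur) big_map.
by rewrite (perm_mem mur) => /mapP[x xr ->] /=; exact: pos xr.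
Qed.

(** The substitution matching the inner redex is composed with [sigma]. A step of [T] can thus be
    replayed at any instance of its label inside a larger term. *)
Lemma pstep_context (s u : term) pi sigma mu : finite_dom sigma ->
  subterm_at s pi = Some (subst sigma u) -> pstep P u mu ->
  pstep P s [seq (pr.1, replace_at s pi (subst sigma pr.2)) | pr <- mu].
Proof.
move=> fs es [r [p [tau [Pr ft eu mur]]]].
exists r, (pi ++ p), (subst sigma \o tau); split => //.
- exact: finite_dom_comp.
- by rewrite subterm_at_cat es /= (subterm_at_subst _ eu) subst_comp.
- rewrite (perm_trans (perm_map _ mur)) // -map_comp; apply/permP => a.
  congr count; apply: eq_map => pr /=; rewrite (replace_at_cat _ _ es) -subst_comp.
  by rewrite (replace_at_subst _ _ eu).
Qed.

End Pstep.

(** * Sums over arbitrary index sets and their finite subsums *)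

Section Esum.
Variables (R : realType) (I : choiceType) (S : set I) (a : I -> R).

Lemma esum_le_fin c :
  (forall F : seq I, uniq F -> {in F, forall i, S i} ->
     \sum_(i <- F) a i <= c) ->
  (\esum_(i in S) (a i)%:E <= c%:E)%E.
Proof.
move=> H; apply: ge_ereal_sup => _ [A [finA AS] <-].
rewrite fsbig_finite //= sumEFin lee_fin; apply: H => //.
by move=> i; rewrite in_fset_set // inE => /AS.
Qed.

Lemma esum_gt_fin c : (c%:E < \esum_(i in S) (a i)%:E)%E ->
  exists F : seq I, [/\ uniq F, {in F, forall i, S i} &
    c < \sum_(i <- F) a i].
Proof.
move=> /ereal_sup_gt[_ [A [finA AS] <-]].
rewrite fsbig_finite //= sumEFin lte_fin => cA.
exists (fset_set A); split => // i; by rewrite in_fset_set // inE => /AS.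
Qed.

Lemma le_esum_fin (F : seq I) : uniq F -> {in F, forall i, S i} ->
  ((\sum_(i <- F) a i)%:E <= \esum_(i in S) (a i)%:E)%E.
Proof.
move=> uF FS; apply: esum_ge; exists [set` F]; first by split => // i /FS.
by rewrite -fsbig_seq // sumEFin.
Qed.

End Esum.

Lemma prefix_rcons_cat (I : eqType) (v w : seq I) i j :
  prefix (rcons v j) (v ++ i :: w) = (j == i).
Proof.
by rewrite -cats1 prefix_catr // eqxx /= prefix0s andbT.
Qed.

(** * Rewrite sequence trees: superharmonic functions and expected visits *)

Section Trees.
Variables (R : realType) (Sigma : finType) (ar : Sigma -> nat) (V : Type).
Variables (P : ptrs R ar V) (T : rst P).
Implicit Types (v w : seq nat).

(** Chosen classically, since [rst] asserts only the existence of such a number, and only at inner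
    nodes; leaves get 0. *)
Definition kids v : nat :=
  xget 0%N [set k | forall j, node T (rcons v j) <-> (j < k)%N].

Definition step_prob v j : R := prob T (rcons v j) / prob T v.

Lemma kidsP v j : node T v -> node T (rcons v j) <-> (j < kids v)%N.
Proof.
move=> nv.
suff: [set k | forall j, node T (rcons v j) <-> (j < k)%N] (kids v) by apply.
apply: xgetPex; case: (pselect (exists j, node T (rcons v j))) => [|no].
  move=> /(node_step nv)[k kP _].
  by exists k.
by exists 0%N => i; split => // ni; case: no; exists i.
Qed.

Lemma node_cat v w : node T (v ++ w) -> node T v.
Proof.
elim/last_ind: w => [|w j IH]; first by rewrite cats0.
by rewrite -rcons_cat => /node_parent.
Qed.

Lemma leafE v : leaf T v <-> node T v /\ kids v = 0%N.
Proof.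
split=> [[nv lv]|[nv kv]].
  by split=> //; case: (posnP (kids v)) => // /(kidsP _ nv)/lv.
by split=> // j /(kidsP _ nv); rewrite kv.
Qed.

Lemma prob_gt0 v : node T v -> 0 < prob T v.
Proof. by move=> /prob_range /andP[]. Qed.

Lemma kids_pstep v : node T v -> (0 < kids v)%N ->
  pstep P (lab T v) [seq (step_prob v j, lab T (rcons v j)) | j <- iota 0 (kids v)].
Proof.
move=> nv kv; have [|k kP] := node_step nv.
  by exists 0%N; apply/kidsP.
suff -> : k = kids v by [].
have lt_kids j : (j < k)%N = (j < kids v)%N.
  by apply/idP/idP => [/kP/(kidsP _ nv)|/(kidsP _ nv)/kP].
apply/eqP; rewrite eqn_leq; apply/andP; split; rewrite leqNgt.
  by rewrite lt_kids ltnn.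
by rewrite -lt_kids ltnn.
Qed.

Lemma step_prob_gt0 v j : node T v -> (j < kids v)%N -> 0 < step_prob v j.
Proof.
by move=> nv jv; rewrite divr_gt0 ?prob_gt0 //; apply/(kidsP _ nv).
Qed.

Lemma sum_step_prob v : node T v -> (0 < kids v)%N ->
  \sum_(j < kids v) step_prob v j = 1.
Proof.
move=> nv kv; have [_] := pstep_distr (kids_pstep nv kv).
by rewrite big_map -{1}(subn0 (kids v)) -/(index_iota 0 (kids v)) big_mkord.
Qed.

Lemma ge_average v (phi : nat -> R) c : node T v -> (0 < kids v)%N ->
  (forall j, (j < kids v)%N -> phi j <= c) ->
  \sum_(j < kids v) step_prob v j * phi j <= c.
Proof.
move=> nv kv H; rewrite -[leRHS]mul1r -(sum_step_prob nv kv) mulr_suml.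
by apply: ler_sum => j _; rewrite ler_pM2l ?H // step_prob_gt0.
Qed.

Lemma le_average v (phi : nat -> R) c : node T v -> (0 < kids v)%N ->
  (forall j, (j < kids v)%N -> c <= phi j) ->
  c <= \sum_(j < kids v) step_prob v j * phi j.
Proof.
move=> nv kv H; rewrite -[leLHS]mul1r -(sum_step_prob nv kv) mulr_suml.
by apply: ler_sum => j _; rewrite ler_pM2l ?H // step_prob_gt0.
Qed.

Lemma ler_average v (phi psi : nat -> R) : node T v ->
  (forall j, (j < kids v)%N -> phi j <= psi j) ->
  \sum_(j < kids v) step_prob v j * phi j <= \sum_(j < kids v) step_prob v j * psi j.
Proof.
by move=> nv H; apply: ler_sum => j _; rewrite ler_pM2l ?H // step_prob_gt0.
Qed.

Lemma leaf_prefix v w : node T v -> leaf T w -> prefix v w ->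
  (kids v = 0%N /\ w = v) \/
  exists2 j, (j < kids v)%N & exists w', w = v ++ j :: w'.
Proof.
move=> nv [nw lw] /prefixP[[|j w'] e].
  left; rewrite e cats0; split=> //; suff [] : node T v /\ kids v = 0%N by [].
  by apply/leafE; split=> // j; rewrite -[v]cats0 -e.
right; exists j; last by exists w'.
by apply/(kidsP _ nv); apply: (@node_cat _ w'); rewrite cat_rcons -e.
Qed.

(** Nonnegativity of [phi] allows discarding the mass that escapes along
    infinite branches. *)
Lemma superharmonic_leaves (g phi : seq nat -> R) D (F : seq (seq nat)) :
  uniq F -> {in F, forall w, leaf T w /\ (size w <= D)%N} ->
  (forall v, node T v -> 0 <= phi v) ->
  (forall v, leaf T v -> g v <= phi v) ->
  (forall v, node T v -> (0 < kids v)%N -> (size v < D)%N ->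
     \sum_(j < kids v) step_prob v j * phi (rcons v j) <= phi v) ->
  \sum_(w <- F) prob T w * g w <= phi [::].
Proof.
move=> uF FD phi0 gphi sup.
(* Only leaves below [v] are summed, and [n] bounds the depth that is left between [v] and [D]. *)
suff H n v : node T v -> (D <= size v + n)%N ->
    \sum_(w <- F | prefix v w) prob T w * g w <= prob T v * phi v.
  have := H D [::] (node_root T) (leqnn _).
  by rewrite prob_root mul1r; under eq_bigl do rewrite prefix0s.
have phi_ge0 u : node T u -> 0 <= prob T u * phi u.
  by move=> nu; rewrite mulr_ge0 ?phi0 // ltW // prob_gt0.
have at_leaf u : node T u -> kids u = 0%N ->
    \sum_(w <- F | prefix u w) prob T w * g w <= prob T u * phi u.
  move=> nu ku; have lu : leaf T u by apply/leafE.
  rewrite big_seq_cond (eq_bigl (fun w => (w \in F) && (w == u))); last first.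
    move=> w; case: (boolP (w \in F)) => //= /FD[lw _].
    apply/idP/eqP => [/(leaf_prefix nu lw)|->]; last exact: prefix_refl.
    by case=> [[]//|[j]]; rewrite ku.
  rewrite -big_seq_cond; case: (boolP (u \in F)) => uF'.
    by rewrite -big_filter filter_pred1_uniq // big_seq1 ler_pM2l ?prob_gt0 ?gphi.
  rewrite big_seq_cond big_pred0 ?phi_ge0 // => w.
  by case: eqP => [->|]; rewrite ?(negbTE uF') ?andbF.
elim: n v => [|n IH] v nv Dv.
all: case: (posnP (kids v)) => kv; first exact: at_leaf.
(* An inner node at depth at least [D] has no leaf of [F] below it. *)
- rewrite big_seq_cond big_pred0 ?phi_ge0 // => w.
  apply/negP => /andP[/FD[lw sw] /(leaf_prefix nv lw)].
  case=> [[k0]|[j _ [w' e]]]; first by rewrite k0 in kv.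
  by move: sw; rewrite e size_cat /=; lia.
- case: (ltnP (size v) D) => svD; last first.
    by apply: (IH v) => //; rewrite (leq_trans svD) // leq_addr.
  (* Every leaf below an inner node lies below exactly one of its children. *)
  have -> : \sum_(w <- F | prefix v w) prob T w * g w =
      \sum_(j < kids v) \sum_(w <- F | prefix (rcons v j) w) prob T w * g w.
    rewrite big_mkcond big_seq.
    under [RHS]eq_bigr do rewrite big_mkcond.
    rewrite exchange_big [RHS]big_seq; apply: eq_bigr => w /FD[lw _].
    case: ifP => [|/negP pvw]; last first.
      rewrite big1 // => j _; case: ifP => // /prefixP[w' e]; case: pvw.
      by apply/prefixP; exists (val j :: w'); rewrite e cat_rcons.
    move=> /(leaf_prefix nv lw)[[k0]|[i ik [w' ->]]]; first by rewrite k0 in kv.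
    rewrite -big_mkcond (big_pred1 (Ordinal ik)) // => j.
    exact: prefix_rcons_cat.
  apply: (@le_trans _ _ (\sum_(j < kids v)
      prob T v * (step_prob v j * phi (rcons v j)))).
    apply: ler_sum => j _.
    rewrite mulrA [_ * step_prob _ _]mulrC divfK ?gt_eqF ?prob_gt0 //.
    by apply: IH; [apply/kidsP|rewrite size_rcons addSnnS].
  by rewrite -mulr_sumr ler_pM2l ?prob_gt0 // sup.
Qed.

(** Finitely many leaves have bounded depth, so the depth-bounded version applies to every finite
    subsum. *)
Lemma superharmonic_esum (g phi : seq nat -> R) :
  (forall v, node T v -> 0 <= phi v) ->
  (forall v, leaf T v -> g v <= phi v) ->
  (forall v, node T v -> (0 < kids v)%N ->
     \sum_(j < kids v) step_prob v j * phi (rcons v j) <= phi v) ->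
  (\esum_(v in leaf T) (prob T v * g v)%:E <= (phi [::])%:E)%E.
Proof.
move=> phi0 gphi sup; apply: esum_le_fin => F uF FS.
apply: (@superharmonic_leaves _ _ (\max_(w <- F) size w)) => //; last first.
  by move=> v nv kv _; apply: sup.
by move=> w wF; split; [apply: FS|exact: (@leq_bigmax_seq _ F xpredT size)].
Qed.

(** Expected number of inner nodes met during [n] steps from [v]. *)
Fixpoint visits n v : R :=
  if n is n'.+1 then
    if kids v == 0%N then 0
    else 1 + \sum_(j < kids v) step_prob v j * visits n' (rcons v j)
  else 0.

Lemma visits_le n v : node T v -> visits n v <= n%:R.
Proof.
elim: n v => [//|n IH] v nv /=; case: eqP => // /eqP; rewrite -lt0n => kv.
rewrite -natr1 addrC lerD2r.
apply: (@ge_average _ (fun j => visits n (rcons v j))) => // j jk.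
by apply: IH; apply/kidsP.
Qed.

(** When no mass escapes, [n] steps visit on average as many inner nodes as the minimum of [n] and
    the depth of the leaf. A finite [edl] thus bounds the visits uniformly in [n]. *)
Lemma visits_le_edl n : (1 <= mass T)%E ->
  ((visits n [::])%:E <= \esum_(v in leaf T) ((size v)%:R * prob T v)%:E)%E.
Proof.
move=> mass1; apply/lee_addgt0Pr => e e0.
(* Leaf mass [d] missing from [F] costs at most [n * d <= e]; the denominator [n.+1] covers
   [n = 0]. *)
pose d := e / n.+1%:R; have n0 : 0 < n.+1%:R :> R by rewrite ltr0n.
have d0 : 0 < d by rewrite divr_gt0.
have [F [uF FT Fd]] : exists F : seq (seq nat),
    [/\ uniq F, {in F, forall i, leaf T i} & 1 - d < \sum_(i <- F) prob T i].
  by apply: esum_gt_fin; apply: lt_le_trans mass1; rewrite lte_fin; lra.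
apply: le_trans (_ : ((\sum_(w <- F) (size w)%:R * prob T w)%:E + e%:E <= _)%E).
  2: by apply: leeD => //; apply: le_esum_fin.
(* [min (size, n) + visits] is harmonic, but its complement to [n] is the
   nonnegative function to which [superharmonic_leaves] applies; total mass 1
   then turns the upper bound into a lower one. *)
pose psi v := n%:R - ((minn (size v) n)%:R + visits (n - size v) v) : R.
have psi_root : psi [::] = n%:R - visits n [::].
  by rewrite /psi /= min0n subn0 add0r.
have := @superharmonic_leaves (fun w => n%:R - (minn (size w) n)%:R) psi
  (\max_(w <- F) size w) F uF.
rewrite psi_root => H.
have {}H : \sum_(w <- F) prob T w * (n%:R - (minn (size w) n)%:R) <=
    n%:R - visits n [::].
  apply: H.
  - by move=> w wF; split; [apply: FT|exact: (@leq_bigmax_seq _ F xpredT size)].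
  - move=> v nv; rewrite subr_ge0.
    apply: le_trans (_ : (minn (size v) n)%:R + (n - size v)%:R <= _).
      by rewrite lerD2l visits_le.
    by rewrite -natrD ler_nat; lia.
  - move=> v /leafE[_ kv]; rewrite /psi.
    suff -> : visits (n - size v) v = 0 by rewrite addr0.
    by case: (n - size v)%N => //= n'; rewrite kv.
  (* Before depth [n], the minimum grows by the one visit that [visits] loses. *)
  - move=> v nv kv _; case: (ltnP (size v) n) => sv.
      have e1 : (n - size v)%N = (n - (size v).+1).+1 by lia.
      rewrite {2}/psi e1 /= gtn_eqF // (minn_idPl (ltnW sv)).
      under eq_bigr => j _ do
        rewrite /psi size_rcons (minn_idPl sv) opprD addrA mulrBr.
      rewrite sumrB -mulr_suml sum_step_prob // mul1r -natr1; lra.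
    (* From depth [n] on, [psi] is 0. *)
    apply: (@ge_average _ (fun j => psi (rcons v j))) => // j _.
    rewrite /psi size_rcons (minn_idPr sv) (minn_idPr (leqW sv)).
    by rewrite (eqP (sv : (n - size v)%N == 0%N)) subnS (eqP (sv : _ == 0%N)).
rewrite -EFinD lee_fin.
have : n%:R * (\sum_(w <- F) prob T w) - \sum_(w <- F) (size w)%:R * prob T w <=
    \sum_(w <- F) prob T w * (n%:R - (minn (size w) n)%:R).
  rewrite mulr_sumr -sumrB big_seq [leRHS]big_seq; apply: ler_sum => w /FT[nw _].
  have : (minn (size w) n)%:R <= (size w)%:R :> R by rewrite ler_nat geq_minl.
  by have := prob_gt0 nw; nra.
have : n%:R * (1 - d) <= n%:R * (\sum_(w <- F) prob T w).
  by rewrite ler_wpM2l // ltW.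
have : n%:R * d <= e.
  rewrite mulrCA -[leRHS]mulr1 ler_pM2l // ler_pdivrMr // mul1r ler_nat.
  exact: leqnSn.
lra.
Qed.

End Trees.

(** * Trees unfolded from a transition system *)

Section Unfolding.
Variables (R : realType) (Sigma : finType) (ar : Sigma -> nat) (V : Type).
Variables (P : ptrs R ar V) (X : Type) (lb : X -> term ar V) (deg : X -> nat).
Variables (wt : X -> nat -> R) (nxt : X -> nat -> X) (Inv : X -> Prop).
Hypothesis Inv_nxt : forall x j, Inv x -> (j < deg x)%N -> Inv (nxt x j).
Hypothesis Inv_pstep : forall x, Inv x -> (0 < deg x)%N ->
  pstep P (lb x) [seq (wt x j, lb (nxt x j)) | j <- iota 0 (deg x)].

Fixpoint is_run x v : bool :=
  if v is j :: v' then (j < deg x)%N && is_run (nxt x j) v' else true.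

Fixpoint run_prob x v : R :=
  if v is j :: v' then wt x j * run_prob (nxt x j) v' else 1.

Lemma is_run_rcons x v j :
  is_run x (rcons v j) = is_run x v && (j < deg (foldl nxt x v))%N.
Proof. by elim: v x => [|i v IH] x /=; rewrite ?andbT // IH andbA. Qed.

Lemma run_prob_rcons x v j :
  run_prob x (rcons v j) = run_prob x v * wt (foldl nxt x v) j.
Proof. by elim: v x => [|i v IH] x /=; rewrite ?mulr1 ?mul1r // IH mulrA. Qed.

Lemma run_Inv x v : Inv x -> is_run x v -> Inv (foldl nxt x v).
Proof.
elim: v x => [//|i v IH] x Ix /= /andP[id rv].
by apply: IH => //; apply: Inv_nxt.
Qed.

Lemma wt_range x j : Inv x -> (j < deg x)%N -> 0 < wt x j <= 1.
Proof.
move=> Ix jd; have d0 : (0 < deg x)%N by case: (deg x) jd.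
have [pos sum1] := pstep_distr (Inv_pstep Ix d0).
have wpos i : (i < deg x)%N -> 0 < wt x i.
  move=> id; apply: (pos (wt x i, lb (nxt x i))).
  by apply: map_f; rewrite mem_iota.
rewrite wpos //= -sum1 big_map -{1}(subn0 (deg x)) -/(index_iota 0 (deg x)).
rewrite big_mkord (bigD1 (Ordinal jd)) //= lerDl sumr_ge0 // => i _.
by rewrite ltW // wpos.
Qed.

Lemma run_prob_range x v : Inv x -> is_run x v -> 0 < run_prob x v <= 1.
Proof.
elim: v x => [|i v IH] x Ix /=; first by rewrite ltr01 lexx.
move=> /andP[id rv]; have /andP[w0 w1] := wt_range Ix id.
have /andP[p0 p1] := IH _ (Inv_nxt Ix id) rv.
by rewrite mulr_gt0 //= mulr_ile1 // ltW.
Qed.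

(** No coinduction is involved: a node is a word of admissible choices, its state is recomputed by
    [foldl], and its probability is the product of the weights along the word. *)
Lemma unfolding x0 : Inv x0 -> exists T : rst P, forall v, node T v ->
  [/\ Inv (foldl nxt x0 v), kids T v = deg (foldl nxt x0 v) &
      forall j, (j < kids T v)%N -> step_prob T v j = wt (foldl nxt x0 v) j].
Proof.
move=> Ix0.
have parent v j : [set v | is_run x0 v] (rcons v j) -> [set v | is_run x0 v] v.
  by rewrite /= is_run_rcons => /andP[].
have step_probE v j : is_run x0 v ->
    run_prob x0 (rcons v j) / run_prob x0 v = wt (foldl nxt x0 v) j.
  move=> rv; have /andP[p0 _] := run_prob_range Ix0 rv.
  by rewrite run_prob_rcons mulrAC divff ?mul1r // gt_eqF.
have step v : [set v | is_run x0 v] v ->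
    (exists j, [set v | is_run x0 v] (rcons v j)) ->
  exists2 k, (forall j, [set v | is_run x0 v] (rcons v j) <-> (j < k)%N) &
    pstep P (lb (foldl nxt x0 v))
      [seq (run_prob x0 (rcons v j) / run_prob x0 v,
            lb (foldl nxt x0 (rcons v j))) | j <- iota 0 k].
  move=> /= rv [j]; rewrite is_run_rcons => /andP[_ jd].
  exists (deg (foldl nxt x0 v)) => [i|].
    by rewrite is_run_rcons rv.
  under eq_map do rewrite step_probE // foldl_rcons.
  by apply: Inv_pstep; [exact: run_Inv|case: deg jd].
pose T := @RST R Sigma ar V P [set v | is_run x0 v] (run_prob x0)
  (fun v => lb (foldl nxt x0 v)) isT parent erefl
  (fun v => @run_prob_range x0 v Ix0) step.
exists T => v rv; have kE : kids T v = deg (foldl nxt x0 v).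
  have H j : (j < kids T v)%N = (j < deg (foldl nxt x0 v))%N.
    apply/idP/idP => [/(@kidsP _ _ _ _ _ T v j rv)|jd].
      by rewrite /= is_run_rcons => /andP[].
    by apply/(@kidsP _ _ _ _ _ T v j rv); rewrite /= is_run_rcons jd andbT.
  apply/eqP; rewrite eqn_leq; apply/andP; split; rewrite leqNgt.
    by rewrite H ltnn.
  by rewrite -H ltnn.
split=> // [|j _]; first exact: run_Inv.
exact: step_probE.
Qed.

End Unfolding.

(** * Rewriting a stack of orthogonal copies along [T] *)

Section Simulation.
Variables (R : realType) (Sigma : finType) (ar : Sigma -> nat) (V : Type).
Variables (P : ptrs R ar V) (T : rst P).
Local Notation term := (term ar V).
Local Notation t := (lab T [::]).

Definition copies v : nat := maxOO t (lab T v).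

(** In [(k, v)], [k] counts the pending orthogonal copies of [t]; the first of
    them is being rewritten along [T] and has reached the node [v]. *)
Definition walk_step (x : nat * seq nat) j : nat * seq nat :=
  if x is (k.+1, v) then
    if kids T (rcons v j) == 0%N then ((k + copies (rcons v j))%N, [::])
    else (k.+1, rcons v j)
  else x.

(** The current term, the positions of its pending copies of [t] (the head one
    being processed), and the node of [T] reached by the head copy. *)
Definition state : Type := term * seq (seq nat) * seq nat.

Definition matcher (s : term) p u : V -> term :=
  if pselect (occurs_at u s p) is left h then s2val (cid2 h) else @Var _ ar V.

Definition copy_positions v : seq (seq nat) :=
  projT1 (cid (maxOO_witness t (lab T v))).

Definition state_deg (x : state) : nat :=
  if x is (_, _ :: _, v) then kids T v else 0.

(** At a leaf of [T], the head position gives way to the occurrences of [t] found in the leaf,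
    shifted by [p]. They go on top of the stack, and the next head starts again at the root of
    [T]. *)
Definition state_next (x : state) j : state :=
  if x is (s, p :: L, v) then
    let s' := replace_at s p
      (subst (matcher s p (lab T v)) (lab T (rcons v j))) in
    if kids T (rcons v j) == 0%N
    then (s', [seq p ++ q | q <- copy_positions (rcons v j)] ++ L, [::])
    else (s', p :: L, rcons v j)
  else x.

(** The node [v] is never a leaf, because leaves are left as soon as they are reached. Only the head
    has been rewritten so far; the other positions still carry fresh instances of [t]. *)
Definition state_inv (x : state) : Prop :=
  let: (s, L, v) := x in
  [/\ node T v, (0 < kids T v)%N, pairwise orthogonal L &
      if L is p :: L' then
        occurs_at (lab T v) s p /\ {in L', forall q, occurs_at t s q}
      else True].

Definition state_abs (x : state) : nat * seq nat := (size x.1.2, x.2).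

Lemma matcherP s p u : occurs_at u s p ->
  finite_dom (matcher s p u) /\
  subterm_at s p = Some (subst (matcher s p u) u).
Proof. by rewrite /matcher; case: pselect => // h _; case: (cid2 h). Qed.

Lemma state_abs_next x j : state_abs (state_next x j) = walk_step (state_abs x) j.
Proof.
case: x => [[s [|p L]] v] //=; case: ifP => _ //=.
rewrite /state_abs /= size_cat size_map addnC.
by rewrite /copy_positions; case: cid => L' [/= -> _ _].
Qed.

Lemma state_pstep x : state_inv x -> (0 < state_deg x)%N ->
  pstep P x.1.1 [seq (step_prob T x.2 j, (state_next x j).1.1)
                | j <- iota 0 (state_deg x)].
Proof.
case: x => [[s [|p L]] v] //= [nv kv _ [/matcherP[fs es] _]] _.
have := pstep_context fs es (kids_pstep nv kv); rewrite -map_comp.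
by congr (pstep _ _ _); apply: eq_map => j /=; case: ifP.
Qed.

(** The other instances are orthogonal to the redex and stay intact. New positions extend [p], hence
    remain orthogonal to the rest, and a common prefix does not affect their mutual orthogonality.
    The root of [T] must be inner for the restart. *)
Lemma state_inv_next x j : (0 < kids T [::])%N ->
  state_inv x -> (j < state_deg x)%N -> state_inv (state_next x j).
Proof.
move=> k0; case: x => [[s [|p L]] v] //= [nv kv /andP[pL oL]].
move=> [/matcherP[fs es] occL] jv.
have nj : node T (rcons v j) by apply/kidsP.
set s' := replace_at _ _ _.
have occj : occurs_at (lab T (rcons v j)) s' p by exact: occurs_at_replace es.
have occL' : {in L, forall q, occurs_at t s' q}.
  move=> q qL; apply: occurs_at_replace_orthogonal; last exact: occL.
  exact: (allP pL).
case: posnP => kj /=; last by split => //; rewrite pL.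
rewrite /copy_positions; case: cid => L' [_ occL0 oL0] /=.
have occ : {in [seq p ++ q | q <- L'] ++ L, forall q, occurs_at t s' q}.
  move=> q; rewrite mem_cat => /orP[/mapP[q' q'L ->]|/occL' //].
  exact: occurs_at_subterm occj (occL0 _ q'L).
split => //; first exact: node_root.
  rewrite pairwise_cat oL andbT; apply/andP; split.
    apply/allrelP => _ q /mapP[q' _ ->] qL.
    by apply: orthogonal_cat_left; apply: (allP pL).
  rewrite pairwise_map; apply: sub_pairwise oL0 => q q' /=.
  by rewrite orthogonal_cat2l.
case: (_ ++ L) occ => // q L0 occ; split.
  by apply: occ; rewrite inE eqxx.
by move=> q' q'L; apply: occ; rewrite inE q'L orbT.
Qed.

(** Terms and positions are forgotten here: the two results on termination only need the Markov
    chain on pairs [(k, v)]. *)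
Definition follows_walk (T' : rst P) (st : seq nat -> nat * seq nat) : Prop :=
  forall w, node T' w ->
  [/\ node T (st w).2, (0 < kids T (st w).2)%N,
      kids T' w = (if (st w).1 == 0%N then 0 else kids T (st w).2)%N &
      forall j, (j < kids T' w)%N ->
        step_prob T' w j = step_prob T (st w).2 j /\
        st (rcons w j) = walk_step (st w) j].

Lemma simulation : (0 < kids T [::])%N ->
  exists T' : rst P, exists2 st, st [::] = (1%N, [::]) & follows_walk T' st.
Proof.
move=> k0; pose x0 : state := (t, [:: [::]], [::]).
have Ix0 : state_inv x0.
  split => //; first exact: node_root.
  split=> //; exists (@Var _ ar V).
    by rewrite /finite_dom; rewrite (_ : mkset _ = set0) // -subset0 => x [].
  rewrite subterm_at_nil; congr Some.
  elim/term_nested_ind: t => [//|f ts IH] /=.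
  by congr App; apply/ffunP => i; rewrite ffunE -IH.
have [T' T'P] := unfolding (fun x j => @state_inv_next x j k0) state_pstep Ix0.
exists T', (fun w => state_abs (foldl state_next x0 w)) => // w.
move=> /T'P[]; case e : (foldl state_next x0 w) => [[s L] v] /= [nv kv _ _] kE rE.
split=> //; first by rewrite kE; case: (L).
move=> j jw; rewrite rE //; split=> //.
by rewrite foldl_rcons e; exact: state_abs_next.
Qed.

End Simulation.

(** * Depth-truncated expectations over the leaves *)

Section TruncatedExpectation.
Variables (R : realType) (Sigma : finType) (ar : Sigma -> nat) (V : Type).
Variables (P : ptrs R ar V) (T : rst P).
Local Notation kids := (kids T).
Local Notation step_prob := (step_prob T).

(** Expected value of [g] at the leaf reached from [v]; branches that are not
    finished after [n] further steps contribute [d]. *)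
Fixpoint expect (d : R) (g : seq nat -> R) n v : R :=
  if kids v == 0%N then g v
  else if n is n'.+1 then
    \sum_(j < kids v) step_prob v j * expect d g n' (rcons v j)
  else d.

Lemma expect_leaf d g n v : kids v = 0%N -> expect d g n v = g v.
Proof. by move=> kv; case: n => [|n] /=; rewrite kv. Qed.

Lemma expectS d g n v : (0 < kids v)%N ->
  expect d g n.+1 v = \sum_(j < kids v) step_prob v j * expect d g n (rcons v j).
Proof. by move=> kv /=; rewrite gtn_eqF. Qed.

Lemma expect_ge0 d g n v : node T v -> 0 <= d -> (forall w, 0 <= g w) ->
  0 <= expect d g n v.
Proof.
move=> + d0 g0; elim: n v => [|n IH] v nv.
  by rewrite /=; case: ifP.
case: (posnP (kids v)) => kv; first by rewrite expect_leaf.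
rewrite expectS // sumr_ge0 // => j _.
rewrite mulr_ge0 ?(ltW (step_prob_gt0 _ _)) //.
by apply: IH; apply/kidsP.
Qed.

Lemma expect_le1 g n v : node T v -> (forall w, g w <= 1) ->
  expect 1 g n v <= 1.
Proof.
move=> + g1; elim: n v => [|n IH] v nv.
  by rewrite /=; case: ifP.
case: (posnP (kids v)) => kv; first by rewrite expect_leaf.
rewrite expectS //.
apply: (@ge_average _ _ _ _ _ _ _ (fun j => expect 1 g n (rcons v j))) => // j jv.
by apply: IH; apply/kidsP.
Qed.

(** [expect] truncated at the remaining depth [D - size v] is harmonic above depth [D] and equals
    [g] at the leaves. *)
Lemma sum_leaves_le_expect (g : seq nat -> R) D (F : seq (seq nat)) :
  uniq F -> {in F, forall w, leaf T w /\ (size w <= D)%N} ->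
  (forall w, 0 <= g w) ->
  \sum_(w <- F) prob T w * g w <= expect 0 g D [::].
Proof.
move=> uF FD g0.
rewrite -[D in leRHS]subn0.
apply: (superharmonic_leaves (phi := fun v => expect 0 g (D - size v) v) uF FD)
  => [v nv|v /leafE[_ kv]|v nv kv sv].
- exact: expect_ge0.
- by rewrite expect_leaf.
- have e : (D - size v)%N = (D - (size v).+1).+1 by lia.
  by rewrite /= e expectS //; under eq_bigr do rewrite size_rcons.
Qed.

(** Second-order companion of Bernoulli's inequality: for small [e] the linear term decides. *)
Lemma exp1B_le (e : R) m : 0 <= e <= 1 ->
  (1 - e) ^+ m <= 1 - e * m%:R + e ^+ 2 * (m%:R ^+ 2).
Proof.
move=> /andP[e0 e1]; elim: m => [|m IH]; first by rewrite expr0; lra.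
rewrite exprS -natr1; have m0 : 0 <= m%:R :> R by [].
apply: (@le_trans _ _ ((1 - e) * (1 - e * m%:R + e ^+ 2 * m%:R ^+ 2))).
  by rewrite ler_wpM2l // subr_ge0.
have : 0 <= e ^+ 2 * m%:R by rewrite mulr_ge0 // exprn_ge0.
have : 0 <= e * e ^+ 2 * m%:R ^+ 2 by rewrite !mulr_ge0 // exprn_ge0.
nra.
Qed.

(** [exp1B_le] averaged over the leaves. The defaults 1, 0 and 0 turn it into [1 <= 1] on unfinished
    branches. *)
Lemma expect_exp_le (e : R) (m : seq nat -> nat) n v : node T v -> 0 <= e <= 1 ->
  expect 1 (fun w => (1 - e) ^+ m w) n v <=
  1 - e * expect 0 (fun w => (m w)%:R) n v +
  e ^+ 2 * expect 0 (fun w => (m w)%:R ^+ 2) n v.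
Proof.
move=> + e01; elim: n v => [|n IH] v nv.
  by rewrite /=; case: ifP => _; [exact: exp1B_le|lra].
case: (posnP (kids v)) => kv; first by rewrite !expect_leaf // exp1B_le.
rewrite !expectS // !mulr_sumr -[X in _ <= X - _ + _](sum_step_prob nv kv).
rewrite -sumrB -big_split /=.
apply: ler_sum => j _.
have := IH (rcons v j) ((kidsP _ nv).2 (ltn_ord j)).
have := step_prob_gt0 nv (ltn_ord j).
set a := expect _ _ _ _; set b := expect _ _ _ _; set c := expect _ _ _ _.
nra.
Qed.

End TruncatedExpectation.

(** * The random walk on the number of copies *)

Section RandomWalk.
Variables (R : realType) (Sigma : finType) (ar : Sigma -> nat) (V : Type).
Variables (P : ptrs R ar V) (T : rst P).
Hypothesis kids_root : (0 < kids T [::])%N.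
Local Notation kids := (kids T).
Local Notation step_prob := (step_prob T).
Local Notation copies := (copies T).
Local Notation walk_step := (walk_step T).

Definition inner v := node T v /\ (0 < kids v)%N.

Lemma inner_root : inner [::].
Proof. by split=> //; exact: node_root. Qed.

(** The waiting copies contribute [q ^+ k], the head the expectation of [q ^+ copies] over the rest
    of its run; a head that gets past depth [D] counts as 1. *)
Definition potential (q : R) D (x : nat * seq nat) : R :=
  if x is (k.+1, v) then
    q ^+ k * expect T 1 (fun w => q ^+ copies w) (D - size v) v
  else 1.

Lemma potential_next q D v k : 0 <= q <= 1 -> inner v ->
  expect T 1 (fun w => q ^+ copies w) D [::] <= q ->
  \sum_(j < kids v) step_prob v j * potential q D (walk_step (k.+1, v) j) <=
  potential q D (k.+1, v).
Proof.
move=> /andP[q0 q1] [nv kv]; set g := fun w => _ => Dq.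
have g1 w : g w <= 1 by rewrite exprn_ile1.
apply: (@le_trans _ _ (\sum_(j < kids v) step_prob v j *
    (q ^+ k * expect T 1 g (D - (size v).+1) (rcons v j)))).
  apply: (@ler_average _ _ _ _ _ _ _
    (fun j => potential q D (walk_step (k.+1, v) j))
    (fun j => q ^+ k * expect T 1 g (D - (size v).+1) (rcons v j))) => // j jv.
  rewrite /walk_step; case: eqP => kj; last by rewrite /= size_rcons.
  (* At a leaf the next copy becomes a fresh head, whose factor is at most [q] by [Dq]. *)
  rewrite expect_leaf // /g -exprD.
  case: (k + _)%N => [|i] //=; rewrite subn0 exprSr.
  by rewrite ler_wpM2l // exprn_ge0.
under eq_bigr do rewrite mulrCA.
rewrite -mulr_sumr ler_wpM2l ?exprn_ge0 //.
case: (ltnP (size v) D) => sv.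
  have -> : (D - size v)%N = (D - (size v).+1).+1 by lia.
  by rewrite expectS.
(* Past depth [D] the head already counts as 1, the largest possible value. *)
have -> : (D - size v)%N = 0%N by lia.
rewrite [leRHS]/= gtn_eqF //.
apply: (@ge_average _ _ _ _ _ _ _
  (fun j => expect T 1 g (D - (size v).+1) (rcons v j))) => // j jv.
by apply: expect_le1 => //; apply/kidsP.
Qed.

Lemma not_AST :
  (1 < \esum_(v in leaf T) (prob T v * (copies v)%:R)%:E)%E -> ~ AST P.
Proof.
move=> /esum_gt_fin[F [uF FT wF]] ast.
pose D := \max_(v <- F) size v.
pose w := expect T 0 (fun v => (copies v)%:R) D [::].
pose c := expect T 0 (fun v => (copies v)%:R ^+ 2) D [::].
have w1 : 1 < w.
  apply: lt_le_trans wF _; apply: sum_leaves_le_expect => // v vF.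
  by split; [apply: FT|exact: (@leq_bigmax_seq _ F xpredT size)].
have c0 : 0 <= c.
  by apply: expect_ge0 (node_root T) _ _ => // v; rewrite exprn_ge0.
(* With [e * c <= w - 1], the bound [1 - e * w + e ^+ 2 * c] is at most [1 - e]. Adding [w] to the
   denominator makes it positive and keeps [e <= 1]. *)
pose e := (w - 1) / (w + c).
have wc0 : 0 < w + c by lra.
have e0 : 0 < e by rewrite divr_gt0 // subr_gt0.
have ewc : e * (w + c) = w - 1 by rewrite divfK // gt_eqF.
have e1 : e <= 1 by rewrite ler_pdivrMr // mul1r; lra.
have [T' [st st0 stP]] := simulation kids_root.
have Dq : expect T 1 (fun v => (1 - e) ^+ copies v) D [::] <= 1 - e.
  have e01 : 0 <= e <= 1 by rewrite e1 ltW.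
  apply: le_trans (expect_exp_le copies D (node_root T) e01) _.
  rewrite -/w -/c.
  have : e * (e * c) <= e * (w - 1) by rewrite ler_pM2l //; nra.
  by rewrite expr2; nra.
have q01 : 0 <= 1 - e <= 1 by rewrite subr_ge0 e1 /=; lra.
have /andP[q0 q1] := q01.
(* Leaves of [T'] have no copies left, so the potential is 1 there, whereas it is at most [1 - e] at
   the start. *)
have : (mass T' <= (potential (1 - e) D (st [::]))%:E)%E.
  rewrite /mass; under eq_esum => v _ do rewrite -[prob T' v]mulr1.
  apply: (@superharmonic_esum _ _ _ _ _ _ (fun=> 1)
    (fun v => potential (1 - e) D (st v))) => v.
  - move=> /stP[nv _ _ _]; rewrite /potential; case: (st v) nv => [[|k] u] //= nv.
    rewrite mulr_ge0 ?exprn_ge0 // expect_ge0 // => u'.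
    by rewrite exprn_ge0.
  - move=> /leafE[nv]; have [_ ku -> _] := stP v nv; case: (st v) ku => [[|k] u] //=.
    by move=> + e2; rewrite e2.
  - move=> nv; have [nu ku kE next_st] := stP v nv => kv.
    under eq_bigr => j _ do
      rewrite (next_st _ (ltn_ord j)).1 (next_st _ (ltn_ord j)).2.
    rewrite kE in kv *; case: (st v) nu ku kv => [[|k] u] //= nu ku kv.
    exact: potential_next.
rewrite st0 (ast T') lee_fin /= mul1r subn0; lra.
Qed.

(** The counterpart of [visits] for the walk, truncated so that it is a real number whether or not
    the walk terminates. *)
Fixpoint chain_visits n (x : nat * seq nat) : R :=
  if n is n'.+1 then
    if x.1 == 0%N then 0
    else 1 + \sum_(j < kids x.2) step_prob x.2 j * chain_visits n' (walk_step x j)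
  else 0.

Lemma chain_visitsS n k v : chain_visits n.+1 (k.+1, v) =
  1 + \sum_(j < kids v) step_prob v j * chain_visits n (walk_step (k.+1, v) j).
Proof. by []. Qed.

Lemma chain_visits0 n v : chain_visits n (0%N, v) = 0.
Proof. by case: n. Qed.

Lemma next_inner x j : inner x.2 -> (j < kids x.2)%N -> inner (walk_step x j).2.
Proof.
case: x => [[|k] v] //= [nv kv] jv; case: eqP => [_|/eqP kj] /=.
  exact: inner_root.
by split; [apply/kidsP|rewrite lt0n].
Qed.

Lemma chain_visits_ge0 n x : inner x.2 -> 0 <= chain_visits n x.
Proof.
elim: n x => [//|n IH] [[|k] v] // iv; rewrite chain_visitsS.
rewrite addr_ge0 // sumr_ge0 // => j _.
by rewrite mulr_ge0 ?(ltW (step_prob_gt0 iv.1 _)) // IH //; apply: next_inner.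
Qed.

Lemma chain_visits_leS n x : inner x.2 -> chain_visits n x <= chain_visits n.+1 x.
Proof.
elim: n x => [|n IH] x iv; first exact: chain_visits_ge0.
case: x iv => [[|k] v] iv //; rewrite 2!chain_visitsS lerD2l.
apply: (@ler_average _ _ _ _ _ _ _ (fun j => chain_visits n (walk_step _ j))
  (fun j => chain_visits n.+1 (walk_step _ j)) iv.1) => j jv.
by apply: IH; apply: next_inner.
Qed.

Lemma chain_visits_mono x : inner x.2 ->
  {homo chain_visits^~ x : m n / (m <= n)%N >-> m <= n}.
Proof.
move=> iv m n /subnK <-; elim: (n - m)%N => [//|d IH].
by apply: le_trans IH _; exact: chain_visits_leS.
Qed.

Lemma chain_visits_leD1 n x : inner x.2 ->
  chain_visits n.+1 x <= 1 + chain_visits n x.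
Proof.
elim: n x => [|n IH] [[|k] v] iv.
1,3: by rewrite 2!chain_visits0 addr0.
  by rewrite chain_visitsS lerD2l big1 // => j _; rewrite mulr0.
rewrite 2!chain_visitsS lerD2l; move: (n.+1) IH => n1 IH.
rewrite -{1}(sum_step_prob iv.1 iv.2) -big_split /=.
apply: ler_sum => j _; rewrite -[X in X + _]mulr1 -mulrDr.
rewrite ler_pM2l ?(step_prob_gt0 iv.1) // IH //.
exact: (@next_inner (k.+1, v)).
Qed.

(* Work placed before the [k] copies can only delay termination. *)
Lemma chain_visits_root_le M l k v : inner v ->
  chain_visits M (k, [::]) <= chain_visits M ((l + k).+1, v).
Proof.
elim: M l k v => [//|M IH] l k v iv.
rewrite chain_visitsS.
(* The right-hand side uses up one step on the extra work, and the visit counted there compensates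
   for it. *)
apply: le_trans (@chain_visits_leD1 M (k, [::]) inner_root) _; rewrite lerD2l.
apply: (@le_average _ _ _ _ _ _ _
  (fun j => chain_visits M (walk_step _ j)) _ iv.1 iv.2).
move=> j jv; have ij := @next_inner (1%N, v) j iv jv.
move: ij => /=; case: eqP => [_ _|_ ij]; last exact: IH.
(* A finished head leaves [l] plus its offspring in front of the [k] copies; if that is nothing,
   both states coincide. *)
case: l => [|l]; last by rewrite addSn addSn addnAC; exact: IH inner_root.
rewrite add0n addnC; case: (copies _) => [//|m].
by rewrite addSn; exact: IH inner_root.
Qed.

Lemma chain_visits_root_mono M k m : (k <= m)%N ->
  chain_visits M (k, [::]) <= chain_visits M (m, [::]).
Proof.
move=> /subnK <-; case: (m - k)%N => [//|d].
by rewrite addSn; exact: chain_visits_root_le inner_root.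
Qed.

(* The [k] additional copies come last, and each of them has its own budget of
   [b] steps. *)
Lemma chain_visits_superadd b k :
  k%:R * chain_visits b (1%N, [::]) <= chain_visits (k * b) (k, [::]) ->
  forall n l v, inner v ->
  chain_visits n (l.+1, v) + k%:R * chain_visits b (1%N, [::]) <=
  chain_visits (n + k * b) ((l + k).+1, v).
Proof.
move=> kb; elim=> [|n IH] l v iv.
  by rewrite add0r; apply: le_trans kb _; exact: chain_visits_root_le.
rewrite addSn 2!chain_visitsS -addrA lerD2l.
set c := k%:R * _.
rewrite -[X in _ + X]mul1r -(sum_step_prob iv.1 iv.2) mulr_suml -big_split /=.
apply: ler_sum => j _; rewrite -mulrDr ler_pM2l ?(step_prob_gt0 iv.1) //.
have := @next_inner (1%N, v) j iv (ltn_ord j).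
move=> /=; case: eqP => [_ _|_ ij]; last exact: IH.
rewrite addnAC; case: (l + copies _)%N => [|i]; last exact: IH inner_root.
(* The work in front is finished early, and its unspent budget passes to the [k] copies. *)
rewrite chain_visits0 add0r add0n; apply: le_trans kb _.
by apply: chain_visits_mono (leq_addl _ _); exact: inner_root.
Qed.

(** The claim for [k] is the premise of [chain_visits_superadd], which then gives it for [k.+1]. *)
Lemma chain_visits_mul b k :
  k%:R * chain_visits b (1%N, [::]) <= chain_visits (k * b) (k, [::]).
Proof.
elim: k => [|k IH]; first by rewrite mul0r.
rewrite -natr1 mulrDl mul1r addrC mulSn.
exact: (chain_visits_superadd IH b 0%N inner_root).
Qed.

(** Renewal inequality: the first step is a visit, and every copy produced within [n] steps gets its
    own budget [b]. The cap [M] makes one total budget sufficient at all leaves. *)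
Lemma chain_visits_unroll M b n v : inner v ->
  (0 < n)%N%:R + expect T 0 (fun w => (minn (copies w) M)%:R) n v *
    chain_visits b (1%N, [::]) <= chain_visits (n + M * b) (1%N, v).
Proof.
set g := fun w => _.
have c0 : 0 <= chain_visits b (1%N, [::]).
  by apply: chain_visits_ge0; exact: inner_root.
elim: n v => [|n IH] v iv.
  rewrite add0r /= gtn_eqF ?iv.2 // mul0r; exact: chain_visits_ge0.
rewrite addSn chain_visitsS lerD2l expectS ?iv.2 // mulr_suml.
apply: ler_sum => j _; rewrite -mulrA ler_pM2l ?(step_prob_gt0 iv.1) //.
have := @next_inner (1%N, v) j iv (ltn_ord j).
move=> /=; case: eqP => [kj _|_ ij].
  rewrite add0n expect_leaf // /g.
  apply: le_trans (chain_visits_mul _ _) _.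
  (* Copies beyond the cap only add visits. *)
  apply: le_trans (chain_visits_root_mono _ (geq_minl _ M)).
  apply: chain_visits_mono; first exact: inner_root.
  by rewrite (leq_trans _ (leq_addl _ _)) // leq_mul2r geq_minr orbT.
by apply: le_trans (IH _ ij); rewrite lerDr.
Qed.

Lemma visits_simulated (T' : rst P) (st : seq nat -> nat * seq nat) :
  follows_walk T T' st ->
  forall n w, node T' w -> visits T' n w = chain_visits n (st w).
Proof.
move=> stP; elim=> [//|n IH] w nw /=.
have [_ kw kE next_st] := stP w nw.
case: (eqVneq (st w).1 0%N) kE => [_ -> //|_ kE].
rewrite kE gtn_eqF //; congr (1 + _); rewrite -kE.
apply: eq_bigr => j _; have [-> <-] := next_st j (ltn_ord j).
by rewrite IH //; apply/kidsP.
Qed.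

Lemma not_PAST :
  (1 <= \esum_(v in leaf T) (prob T v * (copies v)%:R)%:E)%E -> ~ PAST P.
Proof.
move=> sum1 past.
have [T' [st st0 stP]] := simulation kids_root.
(* Under PAST, the finite [edl] of the simulating tree bounds all truncated visit counts at once. *)
have [B B0 visitsB] : exists2 B : R, 0 <= B & forall n,
    chain_visits n (1%N, [::]) <= B.
  have := past T'; rewrite /edl.
  case: (ltP (mass T') 1%E) => [_|mass1]; first by rewrite ltxx.
  set S := (\esum_(v in _) _)%E => Sfin.
  have S0 : (0 <= S)%E.
    apply: esum_ge0 => v [nv _]; rewrite lee_fin mulr_ge0 //.
    by rewrite ltW // prob_gt0.
  have finS : S \is a fin_num by rewrite ge0_fin_numE.
  exists (fine S); first exact: fine_ge0.
  move=> n.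
  rewrite -lee_fin fineK // -st0 -(visits_simulated stP); last exact: node_root.
  exact: visits_le_edl.
(* Chosen so that [d * B <= 1 / 2]: falling short of mean 1 by [d] costs at most half a visit per
   unrolling. *)
pose d := (2 * (B + 1))^-1.
have d0 : 0 < d by rewrite invr_gt0; lra.
have dB : d * (2 * (B + 1)) = 1 by rewrite mulVf // gt_eqF //; lra.
have [F [uF FT wF]] : exists F : seq (seq nat),
    [/\ uniq F, {in F, forall v, leaf T v} &
      1 - d < \sum_(v <- F) prob T v * (copies v)%:R].
  by apply: esum_gt_fin; apply: lt_le_trans sum1; rewrite lte_fin; lra.
pose D := \max_(v <- F) size v; pose M := \max_(v <- F) copies v.
(* On [F] the cap [M] changes nothing, and [D.+1] makes the term [(0 < n)] of [chain_visits_unroll]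
   equal to 1 by computation. *)
pose w := expect T 0 (fun v => (minn (copies v) M)%:R) D.+1 [::].
have wd : 1 - d < w.
  apply: lt_le_trans wF _.
  have -> : \sum_(v <- F) prob T v * (copies v)%:R =
      \sum_(v <- F) prob T v * (minn (copies v) M)%:R.
    rewrite big_seq [RHS]big_seq; apply: eq_bigr => v vF.
    by rewrite (minn_idPl _) //; exact: (@leq_bigmax_seq _ F xpredT copies).
  apply: sum_leaves_le_expect => // v vF; split; first exact: FT.
  by apply: leqW; exact: (@leq_bigmax_seq _ F xpredT size).
(* Each unrolling turns a lower bound [c <= B] into [1 + w * c], which exceeds [c] by at least
   [1 - d * B >= 1 / 2]. *)
have grow i : exists n, i%:R / 2 <= chain_visits n (1%N, [::]).
  elim: i => [|i [b bi]]; first by exists 0%N; rewrite mul0r.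
  exists (D.+1 + M * b)%N.
  apply: le_trans (chain_visits_unroll M b D.+1 inner_root).
  have -> : (0 < D.+1)%N%:R = 1 :> R by [].
  rewrite -/w -natr1.
  have := visitsB b.
  have cb0 : 0 <= chain_visits b (1%N, [::]).
    by apply: chain_visits_ge0; exact: inner_root.
  move: bi cb0; set c := chain_visits b _ => bi cb0 cB.
  have : (1 - d) * c <= w * c by rewrite ler_wpM2r // ltW.
  have : d * c <= d * B by rewrite ler_pM2l.
  lra.
have [n] := grow (Num.bound (2 * B)).
have := visitsB n.
have : 2 * B < (Num.bound (2 * B))%:R by apply: archi_boundP; lra.
lra.
Qed.

End RandomWalk.

Theorem theorem16 (R : realType) (Sigma : finType) (ar : Sigma -> nat)
    (V : Type) (P : ptrs R ar V) (T : rst P) (t : term ar V) :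
  (0 < height T)%E ->
  lab T [::] = t ->
  ((1 < \esum_(v in leaf T) (prob T v * (maxOO t (lab T v))%:R)%:E)%E ->
     ~ AST P) /\
  ((1 <= \esum_(v in leaf T) (prob T v * (maxOO t (lab T v))%:R)%:E)%E ->
     ~ PAST P).
Proof.
move=> h0 <-; have k0 : (0 < kids T [::])%N.
  rewrite lt0n; apply/eqP => k0; move: h0; apply/negP; rewrite -leNgt.
  apply: ge_ereal_sup => _ [[|j w] nw <-] //.
  have : node T (rcons [::] j) by apply: (@node_cat _ _ _ _ _ _ _ w).
  by move=> /(kidsP _ (node_root T)); rewrite k0.
by split; [exact: not_AST|exact: not_PAST].
Qed.
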